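(* There exist problems $P$ and $Q$ such that there is no problem $S$ with the following property: for all problems $R$, $R \leq_c S$ if and only if $R$ is computably reducible to $Q$ followed by $P$.
   Context: A problem $P : \subseteq \omega^\omega \rightrightarrows \omega^\omega$ is a partial multi-function taking $\omega$-valued sequences to sets of $\omega$-valued sequences: it has a domain $\mathrm{dom}(P) \subseteq \omega^\omega$, whose elements are called the instances of $P$ (or $P$-instances), and to each $X \in \mathrm{dom}(P)$ it assigns a set $P(X) \subseteq \omega^\omega$, whose elements are called the $P$-solutions of $X$. Write $\leq_T$ for Turing reducibility and $\oplus$ for the Turing join. Computable reducibility: for problems $P$ and $Q$, $P \leq_c Q$ means that for every $X \in \mathrm{dom}(P)$ there is $\widehat{X} \in \mathrm{dom}(Q)$ with $\widehat{X} \leq_T X$ such that for every $\widehat{Y} \in Q(\widehat{X})$ there is $Y \in P(X)$ with $Y \leq_T X \oplus \widehat{Y}$. For problems $P$, $Q$, $R$, we say that $R$ is computably reducible to $Q$ followed by $P$ if for every $R$-instance $X$ there is a $Q$-instance $\widehat{X} \leq_T X$ such that for every $Q$-solution $\widehat{Y}$ of $\widehat{X}$ there is a $P$-instance $Z \leq_T X \oplus \widehat{Y}$ such that for every $P$-solution $W$ of $Z$ there is an $R$-solution $Y$ of $X$ with $Y \leq_T X \oplus \widehat{Y} \oplus W$. *)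

(* Defs.v *)
From Stdlib Require Import Arith Cantor.

Set Implicit Arguments.

Definition baire : Type := nat -> nat.

(** * Turing reducibility *)

Notation "⟨ x , y ⟩" := (Cantor.to_nat (x, y)) (at level 0, x at level 200, y at level 200).

(** Codes for the unary partial functions that are recursive in an oracle.
    Functions of several arguments are handled through the Cantor pairing. *)
Inductive code : Type :=
| Zero
| Succ
| Left
| Right
| Oracle
| Pair (c d : code)
| Comp (c d : code)
| Prec (c d : code)
| Mu (c : code).

(** Graph of the function defined by primitive recursion from [f] and [h] at
    parameter [a]: [F 0 = f a] and [F (n+1) = h ⟨a, ⟨n, F n⟩⟩]. *)
Fixpoint prec_graph (f h : nat -> nat -> Prop) (a n : nat) : nat -> Prop :=
  match n with
  | 0 => f a
  | S m => fun y => exists v, prec_graph f h a m v /\ h ⟨a, ⟨m, v⟩⟩ y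
  end.

(** [eval g c x y]: the partial function coded by [c], with oracle [g], is
    defined at [x] and takes the value [y] there. *)
Fixpoint eval (g : baire) (c : code) (x y : nat) : Prop :=
  match c with
  | Zero => y = 0
  | Succ => y = S x
  | Left => y = fst (Cantor.of_nat x)
  | Right => y = snd (Cantor.of_nat x)
  | Oracle => y = g x
  | Pair c d => exists u v, eval g c x u /\ eval g d x v /\ y = ⟨u, v⟩
  | Comp c d => exists u, eval g d x u /\ eval g c u y
  | Prec c d =>
      prec_graph (eval g c) (eval g d)
        (fst (Cantor.of_nat x)) (snd (Cantor.of_nat x)) y
  | Mu c =>
      eval g c ⟨x, y⟩ 0 /\
      forall z, z < y -> exists k, eval g c ⟨x, z⟩ (S k)
  end.

Definition turing_le (X Y : baire) : Prop :=
  exists c : code, forall n, eval Y c n (X n).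

Notation "X ≤T Y" := (turing_le X Y) (at level 70, no associativity).

(** [(X ⊕ Y)(2n) = X(n)] and [(X ⊕ Y)(2n+1) = Y(n)]. *)
Definition join (X Y : baire) : baire :=
  fun n => if Nat.even n then X (Nat.div2 n) else Y (Nat.div2 n).

Notation "X ⊕ Y" := (join X Y) (at level 50, left associativity).

(** * Problems *)

(** [sol P X] is the set of [P]-solutions of [X]; it is meaningful only when
    [dom P X] holds, and is only ever consulted in that case.  Instances are
    allowed to have no solution. *)
Record problem : Type := Problem {
  dom : baire -> Prop;
  sol : baire -> baire -> Prop
}.

Definition computably_reducible (P Q : problem) : Prop :=
  forall X, dom P X ->
  exists X', dom Q X' /\ X' ≤T X /\
  forall Y', sol Q X' Y' ->
  exists Y, sol P X Y /\ Y ≤T X ⊕ Y'.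

Notation "P ≤c Q" := (computably_reducible P Q) (at level 70, no associativity).

Definition reducible_to_followed_by (R Q P : problem) : Prop :=
  forall X, dom R X ->
  exists X', dom Q X' /\ X' ≤T X /\
  forall Y', sol Q X' Y' ->
  exists Z, dom P Z /\ Z ≤T X ⊕ Y' /\
  forall W, sol P Z W ->
  exists Y, sol R X Y /\ Y ≤T X ⊕ Y' ⊕ W.

(* Main.v *)
From Stdlib Require Import Arith Cantor Lia ClassicalEpsilon
  FunctionalExtensionality.
Require Import Defs.

(** The intermediate [P]-instance may depend on the [Q]-solution in an
    arbitrary, nonuniform way, whereas [S] has only countably many computable
    instances.  Take reals [G 0, G 1, ...] none of which is computable from the
    join of two others.  Let [Q] have the single instance [0], with solutions
    the [G (n + 2)], and let [P] have the constant instances [0] and [1], whose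
    only solutions are [G 0] and [G 1].  Every [f : nat -> {0, 1}] gives a
    problem with the single instance [0] and solutions [G (n + 2)] joined with
    [G (f n)], and this problem is reducible to [Q] followed by [P].
    Conversely, if [S] is reducible to [Q] followed by [P], each computable
    [S]-instance comes with a choice function [g].  If [f] differs at [n] from
    the function [g] attached to the [n]-th computable [S]-instance, then
    [G (n + 2)] joined with [G (g n)] computes a solution of that instance, but
    no solution of the problem given by [f]. *)

Local Arguments Cantor.to_nat : simpl never.
Local Arguments Cantor.of_nat : simpl never.

(** * Determinism of oracle computations *)

Lemma eval_functional (g : baire) (c : code) (x y y' : nat) :
  eval g c x y -> eval g c x y' -> y = y'.
Proof.
  revert x y y'.
  induction c as [| | | | |c IHc d IHd|c IHc d IHd|c IHc d IHd|c IHc];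
    simpl; intros x y y' H H'; try congruence.
  - destruct H as (u & v & Hu & Hv & ->), H' as (u' & v' & Hu' & Hv' & ->).
    now rewrite (IHc _ _ _ Hu Hu'), (IHd _ _ _ Hv Hv').
  - destruct H as (u & Hu & H), H' as (u' & Hu' & H').
    rewrite (IHd _ _ _ Hu Hu') in H; eauto.
  - revert y y' H H'; generalize (snd (of_nat x)) as n.
    induction n as [|n IHn]; simpl; intros y y' H H'; [eauto|].
    destruct H as (v & Hv & H), H' as (v' & Hv' & H').
    rewrite (IHn _ _ Hv Hv') in H; eauto.
  - destruct H as [H1 H2], H' as [H1' H2'].
    (* If one value were smaller, the search ending at the larger one would have seen a successor
       there, where the other search found [0]. *)
    destruct (Nat.lt_trichotomy y y') as [Hlt|[Heq|Hlt]]; trivial.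
    + destruct (H2' _ Hlt) as [k Hk]; discriminate (IHc _ _ _ H1 Hk).
    + destruct (H2 _ Hlt) as [k Hk]; discriminate (IHc _ _ _ H1' Hk).
Qed.

(** * Finite use *)

Definition agree (L : nat) (g h : baire) : Prop := forall x, x < L -> g x = h x.

Lemma agree_le (L L' : nat) (g h : baire) :
  L <= L' -> agree L' g h -> agree L g h.
Proof. intros HL H x Hx; apply H; lia. Qed.

Lemma bounded_collection (A : nat -> nat -> Prop) (n : nat) :
  (forall z L L', L <= L' -> A z L -> A z L') ->
  (forall z, z < n -> exists L, A z L) ->
  exists L, forall z, z < n -> A z L.
Proof.
  intros Hmono; induction n as [|n IHn]; intros H.
  - exists 0; lia.
  - destruct IHn as [L HL]; [intros z Hz; apply H; lia|].
    destruct (H n) as [M HM]; [lia|].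
    exists (L + M); intros z Hz.
    destruct (Nat.eq_dec z n) as [->|Hne].
    + apply (Hmono _ M); trivial; lia.
    + apply (Hmono _ L); [lia|apply HL; lia].
Qed.

(** A halting computation queries its oracle finitely often. Bounds for subcomputations are added;
    for [Mu], the finitely many failed tests get a common bound by [bounded_collection]. *)
Lemma eval_use (g : baire) (c : code) (x y : nat) :
  eval g c x y -> exists L, forall h, agree L g h -> eval h c x y.
Proof.
  revert x y.
  induction c as [| | | | |c IHc d IHd|c IHc d IHd|c IHc d IHd|c IHc];
    simpl; intros x y H; try (exists 0; now trivial).
  - exists (S x); intros h Hh; rewrite <- Hh; [trivial|lia].
  - destruct H as (u & v & Hu & Hv & ->).
    destruct (IHc _ _ Hu) as [L HL], (IHd _ _ Hv) as [M HM].
    exists (L + M); intros h Hh; exists u, v; repeat split;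
      [apply HL|apply HM]; (eapply agree_le; [|exact Hh]; lia).
  - destruct H as (u & Hu & Hv).
    destruct (IHd _ _ Hu) as [L HL], (IHc _ _ Hv) as [M HM].
    exists (L + M); intros h Hh; exists u; split;
      [apply HL|apply HM]; (eapply agree_le; [|exact Hh]; lia).
  - revert y H; generalize (snd (of_nat x)) as n.
    induction n as [|n IHn]; simpl; intros y H; [now apply IHc|].
    destruct H as (v & Hv & H).
    destruct (IHn _ Hv) as [L HL], (IHd _ _ H) as [M HM].
    exists (L + M); intros h Hh; exists v; split;
      [apply HL|apply HM]; (eapply agree_le; [|exact Hh]; lia).
  - destruct H as [H0 H].
    destruct (IHc _ _ H0) as [L HL].
    destruct (@bounded_collection
      (fun z M => forall h, agree M g h -> exists k, eval h c ⟨x, z⟩ (S k)) y)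
      as [M HM].
    + intros z M M' HMM' HM h Hh; apply HM; now apply (agree_le _ _ _ _ HMM').
    + intros z Hz; destruct (H z Hz) as [k Hk].
      destruct (IHc _ _ Hk) as [M HM]; exists M; eauto.
    + exists (L + M); intros h Hh; split.
      * apply HL; eapply agree_le; [|exact Hh]; lia.
      * intros z Hz; apply HM; trivial; eapply agree_le; [|exact Hh]; lia.
Qed.

(** * Turing reducibility *)

Lemma turing_le_refl (X : baire) : X ≤T X.
Proof. now exists Oracle. Qed.

Fixpoint subst_oracle (e c : code) : code :=
  match c with
  | Oracle => e
  | Pair c d => Pair (subst_oracle e c) (subst_oracle e d)
  | Comp c d => Comp (subst_oracle e c) (subst_oracle e d)
  | Prec c d => Prec (subst_oracle e c) (subst_oracle e d)
  | Mu c => Mu (subst_oracle e c)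
  | _ => c
  end.

Lemma eval_subst_oracle (X Y : baire) (e c : code) (x y : nat) :
  (forall n, eval Y e n (X n)) ->
  eval X c x y -> eval Y (subst_oracle e c) x y.
Proof.
  intros He; revert x y.
  induction c as [| | | | |c IHc d IHd|c IHc d IHd|c IHc d IHd|c IHc];
    simpl; intros x y H; trivial.
  - now subst.
  - destruct H as (u & v & Hu & Hv & ->); exists u, v; auto.
  - destruct H as (u & Hu & H); exists u; auto.
  - revert y H; generalize (snd (of_nat x)) as n.
    induction n as [|n IHn]; simpl; intros y H; [auto|].
    destruct H as (v & Hv & H); exists v; auto.
  - destruct H as [H0 H]; split; auto.
    intros z Hz; destruct (H z Hz) as [k Hk]; exists k; auto.
Qed.

Lemma turing_le_trans (X Y Z : baire) : X ≤T Y -> Y ≤T Z -> X ≤T Z.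
Proof.
  intros [c Hc] [e He]; exists (subst_oracle e c).
  intros n; now apply (eval_subst_oracle Y).
Qed.

Lemma turing_le_ext (X X' Y : baire) :
  (forall n, X n = X' n) -> X ≤T Y -> X' ≤T Y.
Proof. intros H [c Hc]; exists c; intros n; rewrite <- H; apply Hc. Qed.

(** * Closure properties of the functions computable from an oracle *)

Lemma turing_le_comp (F G Z : baire) :
  F ≤T Z -> G ≤T Z -> (fun n => F (G n)) ≤T Z.
Proof. intros [c Hc] [d Hd]; exists (Comp c d); intros n; exists (G n); auto. Qed.

Lemma turing_le_pair (F G Z : baire) :
  F ≤T Z -> G ≤T Z -> (fun n => ⟨F n, G n⟩) ≤T Z.
Proof.
  intros [c Hc] [d Hd]; exists (Pair c d); intros n; exists (F n), (G n); auto.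
Qed.

Lemma turing_le_succ (F Z : baire) : F ≤T Z -> (fun n => S (F n)) ≤T Z.
Proof. apply (@turing_le_comp S); now exists Succ. Qed.

Lemma turing_le_fst (F Z : baire) : F ≤T Z -> (fun n => fst (of_nat (F n))) ≤T Z.
Proof. apply (@turing_le_comp (fun n => fst (of_nat n))); now exists Left. Qed.

Lemma turing_le_snd (F Z : baire) : F ≤T Z -> (fun n => snd (of_nat (F n))) ≤T Z.
Proof. apply (@turing_le_comp (fun n => snd (of_nat n))); now exists Right. Qed.

Lemma turing_le_const (k : nat) (Z : baire) : (fun _ => k) ≤T Z.
Proof.
  induction k as [|k IHk]; [now exists Zero|now apply turing_le_succ in IHk].
Qed.

Lemma turing_le_id (Z : baire) : (fun n => n) ≤T Z.
Proof.
  apply (@turing_le_ext (fun n => ⟨fst (of_nat n), snd (of_nat n)⟩)).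
  - intros n; now rewrite <- surjective_pairing, cancel_to_of.
  - apply turing_le_pair; [now exists Left|now exists Right].
Qed.

Lemma turing_le_prec (F H A B Z : baire) :
  F ≤T Z -> H ≤T Z -> A ≤T Z -> B ≤T Z ->
  (fun n => nat_rec (fun _ => nat) (F (A n))
              (fun m v => H ⟨A n, ⟨m, v⟩⟩) (B n)) ≤T Z.
Proof.
  intros [c Hc] [d Hd] HA HB.
  set (rec := fun x => nat_rec (fun _ => nat) (F (fst (of_nat x)))
    (fun m v => H ⟨fst (of_nat x), ⟨m, v⟩⟩) (snd (of_nat x))).
  apply (@turing_le_ext (fun n => rec ⟨A n, B n⟩)).
  { intros n; unfold rec; now rewrite cancel_of_to. }
  apply (@turing_le_comp rec); [|now apply turing_le_pair].
  unfold rec.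
  exists (Prec c d); intros x; simpl.
  generalize (snd (of_nat x)) as n.
  induction n as [|n IHn]; simpl; [apply Hc|eauto].
Qed.

Lemma turing_le_iter (a : nat) (F B Z : baire) :
  F ≤T Z -> B ≤T Z -> (fun n => Nat.iter (B n) F a) ≤T Z.
Proof.
  intros HF HB.
  eapply turing_le_ext; cycle 1.
  - apply (@turing_le_prec (fun _ => a)
      (fun x => F (snd (of_nat (snd (of_nat x))))) (fun _ => 0) B);
      auto using turing_le_const.
    apply turing_le_comp; auto using turing_le_snd, turing_le_id.
  - intros n; cbv beta; induction (B n) as [|m IHm]; [trivial|].
    cbn [nat_rec nat_rect]; rewrite Nat.iter_succ, <- IHm.
    rewrite cancel_of_to; cbn [snd]; now rewrite cancel_of_to.
Qed.

Lemma turing_le_if_zero (B F G Z : baire) :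
  B ≤T Z -> F ≤T Z -> G ≤T Z ->
  (fun n => if B n =? 0 then F n else G n) ≤T Z.
Proof.
  intros HB HF HG.
  eapply turing_le_ext; cycle 1.
  (* Case distinction is a recursion on [B n] whose step discards the previous value and returns [G]
     of the parameter. *)
  - apply (@turing_le_prec F (fun x => G (fst (of_nat x))) (fun n => n) B);
      auto using turing_le_id.
    apply turing_le_comp; auto using turing_le_fst, turing_le_id.
  - intros n; cbv beta; destruct (B n) as [|m]; [trivial|].
    cbn [nat_rec nat_rect]; rewrite cancel_of_to; trivial.
Qed.

Lemma turing_le_double (Z : baire) : (fun n => 2 * n) ≤T Z.
Proof.
  apply (@turing_le_ext (fun n => Nat.iter n (fun v => S (S v)) 0)).
  - intros n; induction n as [|n IHn]; [trivial|].
    change (S (S (Nat.iter n (fun v => S (S v)) 0)) = 2 * S n); lia.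
  - apply turing_le_iter; auto using turing_le_succ, turing_le_id.
Qed.

Lemma turing_le_div2 (Z : baire) : Nat.div2 ≤T Z.
Proof.
  (* Halving slides a window of two values, since [div2 (S (S n)) = S (div2 n)]. *)
  set (step := fun p => ⟨snd (of_nat p), S (fst (of_nat p))⟩).
  assert (Hstep : forall n,
    Nat.iter n step ⟨0, 0⟩ = ⟨Nat.div2 n, Nat.div2 (S n)⟩).
  { intros n; induction n as [|n IHn]; [trivial|].
    rewrite Nat.iter_succ, IHn; unfold step; now rewrite cancel_of_to. }
  apply (@turing_le_ext (fun n => fst (of_nat (Nat.iter n step ⟨0, 0⟩)))).
  - intros n; now rewrite Hstep, cancel_of_to.
  - apply turing_le_fst, turing_le_iter; unfold step;
      auto using turing_le_pair, turing_le_fst, turing_le_snd, turing_le_succ,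
        turing_le_id.
Qed.

Lemma turing_le_odd (Z : baire) : (fun n => Nat.b2n (Nat.odd n)) ≤T Z.
Proof.
  apply (@turing_le_ext
    (fun n => Nat.iter n (fun v => if v =? 0 then 1 else 0) 0)).
  - intros n; induction n as [|n IHn]; [trivial|].
    rewrite Nat.iter_succ, IHn, Nat.odd_succ, <- Nat.negb_odd.
    now destruct (Nat.odd n).
  - apply turing_le_iter; auto using turing_le_id.
    apply (@turing_le_if_zero (fun v => v) (fun _ => 1) (fun _ => 0));
      auto using turing_le_id, turing_le_const.
Qed.

(** * The join as a least upper bound *)

Lemma turing_le_join_l (X Y : baire) : X ≤T X ⊕ Y.
Proof.
  apply (@turing_le_ext (fun n => (X ⊕ Y) (2 * n))).
  - intros n; unfold join; rewrite Nat.even_even, Nat.div2_double; trivial.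
  - apply turing_le_comp; auto using turing_le_refl, turing_le_double.
Qed.

Lemma turing_le_join_r (X Y : baire) : Y ≤T X ⊕ Y.
Proof.
  apply (@turing_le_ext (fun n => (X ⊕ Y) (S (2 * n)))).
  - intros n; unfold join.
    rewrite Nat.even_succ, Nat.odd_even, Nat.div2_succ_double; trivial.
  - apply turing_le_comp;
      auto using turing_le_refl, turing_le_succ, turing_le_double.
Qed.

Lemma turing_le_join_lub (X Y Z : baire) : X ≤T Z -> Y ≤T Z -> X ⊕ Y ≤T Z.
Proof.
  intros HX HY.
  apply (@turing_le_ext (fun n =>
    if Nat.b2n (Nat.odd n) =? 0 then X (Nat.div2 n) else Y (Nat.div2 n))).
  - intros n; unfold join; rewrite <- Nat.negb_odd; now destruct (Nat.odd n).
  - apply (@turing_le_if_zero (fun n => Nat.b2n (Nat.odd n))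
      (fun n => X (Nat.div2 n)) (fun n => Y (Nat.div2 n)));
      auto using turing_le_odd, turing_le_comp, turing_le_div2.
Qed.

(** This allows [R := S] in the supposed equivalence, so that [S] itself reduces to [Q] followed by
    [P]. *)
Lemma computably_reducible_refl (S : problem) : S ≤c S.
Proof.
  intros X HX; exists X; repeat split; auto using turing_le_refl.
  intros Y HY; exists Y; split; auto using turing_le_join_r.
Qed.

(** * An independent sequence of reals *)

Fixpoint encode (c : code) : nat :=
  match c with
  | Zero => ⟨0, 0⟩
  | Succ => ⟨1, 0⟩
  | Left => ⟨2, 0⟩
  | Right => ⟨3, 0⟩
  | Oracle => ⟨4, 0⟩
  | Pair c d => ⟨5, ⟨encode c, encode d⟩⟩
  | Comp c d => ⟨6, ⟨encode c, encode d⟩⟩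
  | Prec c d => ⟨7, ⟨encode c, encode d⟩⟩
  | Mu c => ⟨8, encode c⟩
  end.

Lemma encode_inj (c d : code) : encode c = encode d -> c = d.
Proof.
  revert d; induction c; intros [] H; cbn [encode] in H;
    apply to_nat_inj in H; try discriminate H; trivial;
    injection H as H; f_equal; auto;
    apply to_nat_inj in H; injection H as H1 H2; auto.
Qed.

Lemma code_enumeration : exists dec : nat -> code, forall c, exists n, dec n = c.
Proof.
  exists (fun n => epsilon (inhabits Zero) (fun c => encode c = n)).
  intros c; exists (encode c); apply encode_inj.
  exact (epsilon_spec (inhabits Zero) (fun d => encode d = encode c)
           (ex_intro _ c eq_refl)).
Qed.

(** Finite-extension forcing: a pair of [H] and [L] stands for the finite string of the first [L]
    values of [H]. A chain of strings, the one chosen at step [s] forcing [D s], has a limit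
    extending them all. *)
Lemma finite_extension (D : nat -> baire -> Prop) :
  (forall s H L, exists H' L', agree L H H' /\
     forall H'', agree L' H' H'' -> D s H'') ->
  exists H, forall s, D s H.
Proof.
  intros Hext.
  assert (Hstep : forall s (p : baire * nat), exists q : baire * nat,
    s < snd q /\ snd p <= snd q /\ agree (snd p) (fst p) (fst q) /\
    forall H, agree (snd q) (fst q) H -> D s H).
  { intros s [H L]; destruct (Hext s H L) as (H' & L' & HH & HD).
    exists (H', L' + L + S s); simpl; repeat split; try lia; trivial.
    intros H'' HH''; apply HD; eapply agree_le; [|exact HH'']; lia. }
  set (step := fun s p =>
    proj1_sig (constructive_indefinite_description _ (Hstep s p))).
  assert (Hs : forall s p, s < snd (step s p) /\ snd p <= snd (step s p) /\
    agree (snd p) (fst p) (fst (step s p)) /\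
    forall H, agree (snd (step s p)) (fst (step s p)) H -> D s H).
  { intros s p; unfold step.
    exact (proj2_sig (constructive_indefinite_description _ (Hstep s p))). }
  clearbody step.
  set (q := nat_rect (fun _ => (baire * nat)%type) (fun _ => 0, 0) step).
  assert (Hq : forall s d, snd (q s) <= snd (q (d + s)) /\
    agree (snd (q s)) (fst (q s)) (fst (q (d + s)))).
  { intros s d; induction d as [|d [IH1 IH2]]; [now split|].
    destruct (Hs (d + s) (q (d + s))) as (_ & H1 & H2 & _).
    change (q (S d + s)) with (step (d + s) (q (d + s))).
    split; [lia|].
    intros x Hx; rewrite IH2 by trivial; apply H2; lia. }
  (* Stage [S n] has length greater than [n], so it has settled the value at [n]. *)
  exists (fun n => fst (q (S n)) n); intros s.
  destruct (Hs s (q s)) as (_ & _ & _ & HD).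
  apply HD; intros x Hx.
  change (step s (q s)) with (q (S s)) in *.
  assert (Hx' : x < snd (q (S x))) by apply (Hs x (q x)).
  destruct (Nat.le_ge_cases s x) as [Hle|Hle].
  - destruct (Hq (S s) (x - s)) as [_ H].
    replace (x - s + S s) with (S x) in H by lia; auto.
  - destruct (Hq (S x) (s - x)) as [_ H].
    replace (s - x + S x) with (S s) in H by lia; symmetry; auto.
Qed.

Definition column (H : baire) (i : nat) : baire := fun n => H ⟨i, n⟩.

Lemma join_column_use (H : baire) (i j L : nat) :
  exists M, forall H', agree M H H' ->
    agree L (column H i ⊕ column H j) (column H' i ⊕ column H' j).
Proof.
  destruct (@bounded_collection (fun x M => forall H', agree M H H' ->
    (column H i ⊕ column H j) x = (column H' i ⊕ column H' j) x) L)
    as [M HM].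
  - intros z M M' HMM' HM H' HH'; apply HM; now apply (agree_le _ _ _ _ HMM').
  - intros x _; unfold join, column; destruct (Nat.even x).
    + exists (S ⟨i, Nat.div2 x⟩); intros H' HH'; apply HH'; lia.
    + exists (S ⟨j, Nat.div2 x⟩); intros H' HH'; apply HH'; lia.
  - exists M; intros H' HH' x Hx; now apply HM.
Qed.

(** Either some extension makes [c] converge at input [L], and column [k] is then changed there to
    disagree, or no extension does, and [H] up to [L] already prevents [c] from computing column
    [k]. *)
Lemma column_diagonalization (c : code) (i j k : nat) (H : baire) (L : nat) :
  k <> i -> k <> j ->
  exists H' L', agree L H H' /\ forall H'', agree L' H' H'' ->
    ~ forall n, eval (column H'' i ⊕ column H'' j) c n (column H'' k n).
Proof.
  intros Hi Hj.
  destruct (classic (exists H' y, agree L H H' /\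
    eval (column H' i ⊕ column H' j) c L y)) as [(H' & y & HH' & Hy)|Hno].
  - set (p := ⟨k, L⟩).
    (* The input [L] was chosen so that its position [p] in column [k] lies beyond the part already
       fixed. *)
    assert (Hp : L <= p) by (pose proof (to_nat_non_decreasing k L); lia).
    (* Altering the value at [p] changes only the [k]-th column, so the
       computation of [y] survives. *)
    set (K := fun x => if x =? p then S y else H' x).
    assert (HK : forall l, l <> k -> forall n, column K l n = column H' l n).
    { intros l Hl n; unfold column, K.
      destruct (Nat.eqb_spec ⟨l, n⟩ p) as [E|]; trivial.
      apply to_nat_inj in E; congruence. }
    destruct (eval_use _ _ _ _ Hy) as [M HM].
    destruct (join_column_use K i j M) as [N HN].
    exists K, (N + S p); split.
    + intros x Hx; unfold K; destruct (Nat.eqb_spec x p); [lia|auto].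
    + intros H'' HH'' Hall.
      assert (E : y = column H'' k L).
      { apply (eval_functional (column H'' i ⊕ column H'' j) c L); [|trivial].
        apply HM; intros x Hx.
        transitivity ((column K i ⊕ column K j) x).
        - unfold join; now rewrite !HK by auto.
        - apply HN; trivial; eapply agree_le; [|exact HH'']; lia. }
      unfold column in E; fold p in E; rewrite <- HH'' in E by lia.
      unfold K in E; rewrite Nat.eqb_refl in E; lia.
  - exists H, L; split; [now intros x|].
    intros H'' HH'' Hall; apply Hno; eauto.
Qed.

(** The columns of a single generic real work: the requirements, one for each code and each triple
    of indices, are countably many, and [s] codes such a quadruple. *)
Lemma independent_sequence :
  exists G : nat -> baire, forall i j k,
    k <> i -> k <> j -> ~ G k ≤T G i ⊕ G j.
Proof.
  destruct code_enumeration as [dec Hdec].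
  destruct (@finite_extension (fun s H =>
    let (e, t) := of_nat s in let (i, t) := of_nat t in
    let (j, k) := of_nat t in
    k <> i -> k <> j ->
    ~ forall n, eval (column H i ⊕ column H j) (dec e) n (column H k n)))
    as [H HG].
  - intros s H L.
    destruct (of_nat s) as [e t], (of_nat t) as [i u], (of_nat u) as [j k].
    destruct (Nat.eq_dec k i) as [Hi|Hi]; [exists H, L; now split|].
    destruct (Nat.eq_dec k j) as [Hj|Hj]; [exists H, L; now split|].
    destruct (column_diagonalization (dec e) i j k H L Hi Hj) as (H' & L' & H1 & H2).
    exists H', L'; auto.
  - exists (column H); intros i j k Hi Hj [c Hc].
    destruct (Hdec c) as [e <-].
    specialize (HG ⟨e, ⟨i, ⟨j, k⟩⟩⟩); rewrite !cancel_of_to in HG.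
    now apply HG.
Qed.

(** * The two problems and the diagonalization against [S] *)

Theorem theorem3p2 :
  exists P Q : problem,
    ~ exists S : problem,
        forall R : problem, R ≤c S <-> reducible_to_followed_by R Q P.
Proof.
  destruct independent_sequence as [G HG].
  destruct code_enumeration as [dec Hdec].
  set (O := (fun _ => 0) : baire).
  exists (Problem (fun Z => exists b, b < 2 /\ Z = fun _ => b)
                  (fun Z W => W = G (Z 0))).
  exists (Problem (fun X => X = O) (fun _ Y => exists n, Y = G (2 + n))).
  intros [S HS].
  (* The choice function is attached to the code [e]: by determinism, [e] computes at most one
     instance from [O]. A code computing no [S]-instance gets a dummy function. *)
  assert (Hg : forall e, exists g : nat -> nat, forall X,
    dom S X -> (forall n, eval O e n (X n)) ->
    forall n, g n < 2 /\
      exists Y, sol S X Y /\ Y ≤T X ⊕ G (2 + n) ⊕ G (g n)).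
  { intros e.
    destruct (classic (exists X, dom S X /\ forall n, eval O e n (X n)))
      as [(X & HX & He)|Hno].
    - destruct (proj1 (HS S) (computably_reducible_refl S) X HX)
        as (X' & _ & _ & Hsol).
      assert (Hn : forall n, exists b, b < 2 /\
        exists Y, sol S X Y /\ Y ≤T X ⊕ G (2 + n) ⊕ G b).
      { intros n.
        destruct (Hsol (G (2 + n)) (ex_intro _ n eq_refl))
          as (Z & (b & Hb & ->) & _ & HW).
        exists b; split; [exact Hb|now apply HW]. }
      exists (fun n => proj1_sig (constructive_indefinite_description _ (Hn n))).
      intros X1 HX1 He1 n.
      replace X1 with X
        by (extensionality m; exact (eval_functional _ _ _ _ _ (He m) (He1 m))).
      exact (proj2_sig (constructive_indefinite_description _ (Hn n))).
    - exists (fun _ => 0); intros X HX He; exfalso; eauto. }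
  set (g := fun n =>
    proj1_sig (constructive_indefinite_description _ (Hg (dec n))) n).
  (* Truncated subtraction keeps [f n < 2] in every case, and makes [f n] differ from [g n] whenever
     [g n < 2]. *)
  set (f := fun n => 1 - g n).
  (* The solutions have exactly the form [X ⊕ Y' ⊕ W], so the final reduction to [Q] followed by [P]
     is reflexivity. *)
  set (R := Problem (fun X => X = O)
    (fun X Y => exists n, Y = X ⊕ G (2 + n) ⊕ G (f n))).
  assert (HR : R ≤c S).
  { apply HS; intros X ->; exists O; repeat split; [apply turing_le_refl|].
    intros Y' [n ->]; exists (fun _ => f n); repeat split.
    - exists (f n); split; [unfold f; lia|trivial].
    - apply turing_le_const.
    - intros W ->; exists (O ⊕ G (2 + n) ⊕ G (f n)); split; [|apply turing_le_refl].
      exists n; trivial. }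
  destruct (HR O eq_refl) as (X & HX & HXO & Hsol).
  destruct HXO as [e He], (Hdec e) as [n Hn].
  assert (Hgn : g n < 2 /\
    exists Y, sol S X Y /\ Y ≤T X ⊕ G (2 + n) ⊕ G (g n)).
  { apply (proj2_sig (constructive_indefinite_description _ (Hg (dec n))));
      [trivial|now rewrite Hn]. }
  destruct Hgn as (Hlt & Y & HY & HYle).
  destruct (Hsol Y HY) as (V & [m ->] & HV).
  assert (HO : forall Z, O ≤T Z) by apply turing_le_const.
  (* The instance [X] is computable, so it drops out of the join. *)
  assert (HYG : Y ≤T G (2 + n) ⊕ G (g n)).
  { apply (turing_le_trans _ _ _ HYle), turing_le_join_lub;
      [apply turing_le_join_lub|apply turing_le_join_r].
    - apply (turing_le_trans _ O); [now exists e|apply HO].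
    - apply turing_le_join_l. }
  assert (HVG : O ⊕ G (2 + m) ⊕ G (f m) ≤T G (2 + n) ⊕ G (g n)).
  { apply (turing_le_trans _ _ _ HV), turing_le_join_lub; trivial. }
  (* The solution of [R] found may use any index [m]. If [m = n], the real [G (f n)] contradicts
     independence, as [f n] differs from [g n] and is below [2]; otherwise [G (2 + m)] does, as
     [g n] is below [2]. *)
  destruct (Nat.eq_dec m n) as [->|Hne].
  - apply (HG (2 + n) (g n) (f n)); [unfold f; lia|unfold f; lia|].
    apply (turing_le_trans _ _ _ (turing_le_join_r _ _) HVG).
  - apply (HG (2 + n) (g n) (2 + m)); [lia|lia|].
    apply (turing_le_trans _ (O ⊕ G (2 + m))); [apply turing_le_join_r|].
    apply (turing_le_trans _ _ _ (turing_le_join_l _ _) HVG).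
Qed.
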